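(* Let $k>1$ and suppose Assumption A (stated in the context) holds. Let $(x(t),v_1(t),\dots,v_k(t))$ be the solution on $[0,T]$ of the index-$k$ saddle dynamics with $x(0)=x_0$, $v_i(0)=v_{i,0}$, $v_{i,0}^\top v_{j,0}=\delta_{i,j}$ for $1\le i,j\le k$, and let $\{x_n,v_{1,n},\dots,v_{k,n}\}_{n=1}^{N_T}$ be generated from the same initial data by the explicit Euler scheme with Gram–Schmidt orthonormalization and step size $\tau=T/N_T$ described in the context. Define $e^x_n:=x(t_n)-x_n$ and $e^v_{i,n}:=v_i(t_n)-v_{i,n}$ for $1\le n\le N_T$, $1\le i\le k$, where $t_n=n\tau$. Then the following estimate holds for $\tau$ sufficiently small: $$\|e^x_{n}\|+\sum_{i=1}^k\|e^v_{i,n}\|\leq Q\tau,\qquad 1\leq n\leq N_T.$$ Here $Q$ depends on $k$, $L$, $T$ and $\beta$ but is independent of $\tau$, $n$ and $N_T$.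
   Context: $\|\cdot\|$ is the standard $l^2$ norm of a vector or a matrix, $I$ is the $N\times N$ identity, and $\delta_{i,j}=1$ if $i=j$ and $\delta_{i,j}=0$ otherwise. $E:\mathbb R^N\to\mathbb R$ is twice Fréchet differentiable, $F(x)=-\nabla E(x)$ and $J(x)=-\nabla^2E(x)$ (so $J(x)=J(x)^\top$). $\beta,\gamma>0$ are relaxation parameters and $T>0$ is a terminal time. Assumption A: there is a constant $L>0$ such that for all $x,x_1,x_2\in\mathbb R^N$, $$\|J(x_2)-J(x_1)\|+\|F(x_2)-F(x_1)\|\leq L\|x_2-x_1\|,\qquad \|F(x)\|\leq L(1+\|x\|).$$ Index-$k$ saddle dynamics: $$\frac{dx}{dt}=\beta\Big(I-2\sum_{j=1}^kv_jv_j^\top\Big)F(x),\qquad \frac{dv_i}{dt}=\gamma\Big(I-v_iv_i^\top-2\sum_{j=1}^{i-1}v_jv_j^\top\Big)J(x)v_i,\quad 1\le i\le k,$$ with initial conditions $x(0)=x_0$, $v_i(0)=v_{i,0}$, where $v_{i,0}^\top v_{j,0}=\delta_{i,j}$ for $1\le i,j\le k$. Explicit Euler scheme: for $N_T\in\mathbb N$, $\tau=T/N_T$, $t_n=n\tau$, starting from the given $x_0,v_{1,0},\dots,v_{k,0}$, for $1\le n\le N_T$, $$x_n=x_{n-1}+\tau\beta\Big(I-2\sum_{j=1}^kv_{j,n-1}v_{j,n-1}^\top\Big)F(x_{n-1}),$$ $$\tilde v_{i,n}=v_{i,n-1}+\tau\gamma\Big(I-v_{i,n-1}v_{i,n-1}^\top-2\sum_{j=1}^{i-1}v_{j,n-1}v_{j,n-1}^\top\Big)J(x_{n-1})v_{i,n-1},\quad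 1\le i\le k,$$ $$v_{i,n}=\frac1{Y_{i,n}}\Big(\tilde v_{i,n}-\sum_{j=1}^{i-1}(\tilde v_{i,n}^\top v_{j,n})v_{j,n}\Big),\qquad Y_{i,n}=\Big\|\tilde v_{i,n}-\sum_{j=1}^{i-1}(\tilde v_{i,n}^\top v_{j,n})v_{j,n}\Big\|,\quad 1\le i\le k.$$
   Formalization: Q (and the smallness threshold for τ) may depend on γ and ‖x_0‖ besides k, L, T and β: with E=-c‖x‖²/2 the error scales with ‖x_0‖, and with E quadratic and x_0=0 it scales with γ, so a Q depending only on k, L, T, β cannot exist. *)

(* Defs.v *)
From HB Require Import structures.
From mathcomp Require Import all_boot all_order all_algebra.
From mathcomp Require Import all_classical all_reals all_analysis.
Import Order.TTheory GRing.Theory Num.Theory.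
Import numFieldNormedType.Exports.

Set Implicit Arguments.
Unset Strict Implicit.
Unset Printing Implicit Defensive.

Local Open Scope classical_set_scope.
Local Open Scope ring_scope.

Definition dot (R : realType) (N : nat) (u v : 'cV[R]_N) : R :=
  (u^T *m v) 0 0.

(* Euclidean norm.  The norm `|u| that the library puts on matrices is the
   maximum norm: it is used below only through the topology it induces, which
   is the Euclidean one. *)
Definition norm2 (R : realType) (N : nat) (u : 'cV[R]_N) : R :=
  Num.sqrt (dot u u).

(* l^2 norm of a matrix: the operator norm induced by [norm2]. *)
Definition mxnorm2 (R : realType) (N : nat) (A : 'M[R]_N) : R :=
  sup [set norm2 (A *m u) | u in [set u : 'cV[R]_N | norm2 u <= 1]].

Definition grad (R : realType) (N : nat) (E : 'cV[R]_N -> R) (x : 'cV[R]_N) :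
    'cV[R]_N :=
  \col_i 'D_(delta_mx i 0) E x.

Definition hess (R : realType) (N : nat) (E : 'cV[R]_N -> R) (x : 'cV[R]_N) :
    'M[R]_N :=
  \matrix_(i, j) 'D_(delta_mx j 0) (fun y => grad E y i 0) x.

(* [differentiable] is Fréchet differentiability; the derivative of E is
   identified with its gradient. *)
Definition twice_differentiable (R : realType) (N : nat)
    (E : 'cV[R]_N -> R) : Prop :=
  forall x, differentiable E x /\ differentiable (grad E) x.

Definition force (R : realType) (N : nat) (E : 'cV[R]_N -> R)
  (x : 'cV[R]_N) : 'cV[R]_N := - grad E x.

Definition force_jac (R : realType) (N : nat) (E : 'cV[R]_N -> R)
  (x : 'cV[R]_N) : 'M[R]_N := - hess E x.

Definition assumptionA (R : realType) (N : nat) (E : 'cV[R]_N -> R)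
    (L : R) : Prop :=
  (forall x1 x2 : 'cV[R]_N,
     mxnorm2 (force_jac E x2 - force_jac E x1)
       + norm2 (force E x2 - force E x1) <= L * norm2 (x2 - x1)) /\
  (forall x : 'cV[R]_N, norm2 (force E x) <= L * (1 + norm2 x)).

Definition orthonormal_family (R : realType) (N k : nat)
    (v : 'I_k -> 'cV[R]_N) : Prop :=
  forall i j, dot (v i) (v j) = (i == j)%:R.

Section SaddleDynamics.
Variables (R : realType) (N k : nat).
Variables (E : 'cV[R]_N -> R) (beta gamma : R).

Definition x_field (x : 'cV[R]_N) (v : 'I_k -> 'cV[R]_N) : 'cV[R]_N :=
  beta *: ((1%:M - 2 *: \sum_(j < k) v j *m (v j)^T) *m force E x).

Definition v_field (x : 'cV[R]_N) (v : 'I_k -> 'cV[R]_N) (i : 'I_k) :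
    'cV[R]_N :=
  gamma *: ((1%:M - v i *m (v i)^T
             - 2 *: \sum_(j < k | (j < i)%N) v j *m (v j)^T)
            *m (force_jac E x *m v i)).

(* Classical solution on [0, T]: continuous on [0, T] and satisfying the
   equations on ]0, T[.  The right-hand sides being continuous, the equations
   then hold at 0 and T too, with one-sided derivatives. *)
Definition saddle_solution (T : R) (x0 : 'cV[R]_N) (v0 : 'I_k -> 'cV[R]_N)
    (x : R -> 'cV[R]_N) (v : 'I_k -> R -> 'cV[R]_N) : Prop :=
  [/\ x 0 = x0 /\ (forall i, v i 0 = v0 i),
      {within `[0, T], continuous x} /\
      (forall i, {within `[0, T], continuous (v i)}),
      forall t : R, 0 < t < T -> is_derive t 1 x (x_field (x t) (v ^~ t)) &
      forall (i : 'I_k) (t : R), 0 < t < T ->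
        is_derive t 1 (v i) (v_field (x t) (v ^~ t) i)].

(* [vt i] minus its components along the [v j] with j < i. *)
Definition gs_residual (vt v : 'I_k -> 'cV[R]_N) (i : 'I_k) : 'cV[R]_N :=
  vt i - \sum_(j < k | (j < i)%N) dot (vt i) (v j) *: v j.

(* No condition is put on the normalisation factor; it would be 0^-1 = 0 if
   the residual vanished. *)
Definition euler_scheme (tau : R) (NT : nat) (x0 : 'cV[R]_N)
    (v0 : 'I_k -> 'cV[R]_N) (x : nat -> 'cV[R]_N)
    (v : 'I_k -> nat -> 'cV[R]_N) : Prop :=
  [/\ x 0%N = x0, forall i, v i 0%N = v0 i &
      forall n, (1 <= n <= NT)%N ->
        x n = x n.-1 + tau *: x_field (x n.-1) (v ^~ n.-1) /\
        (forall i, let vt j := v j n.-1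
                               + tau *: v_field (x n.-1) (v ^~ n.-1) j in
           let w := gs_residual vt (v ^~ n) i in
           v i n = (norm2 w)^-1 *: w)].

End SaddleDynamics.

(* Main.v *)
Require Import Defs.
From HB Require Import structures.
From mathcomp Require Import all_boot all_order all_algebra.
From mathcomp Require Import all_classical all_reals all_analysis.
From mathcomp Require Import ring lra.
Import Order.TTheory GRing.Theory Num.Theory.
Import numFieldNormedType.Exports.

Local Open Scope classical_set_scope.
Local Open Scope ring_scope.

(* Because J(x) is symmetric, d/dt <v_i, v_j> along the flow is linear in the
   deviations of the <v_l, v_m> from orthonormality, so these vanish by Gronwall.
   Then I - 2 sum_j v_j v_j^T is bounded independently of the solution, x(t) stays
   bounded because F has linear growth, and both fields are Lipschitz on the
   relevant states, with |J(x) u| <= L |u| since F is L-Lipschitz.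
   For the scheme, the same cancellation gives <vt_i, vt_j> = delta_ij + O(tau^2)
   for the predictors vt_i, so Gram-Schmidt moves them by O(tau^2) only; the local
   error is thus O(tau^2) and a discrete Gronwall inequality concludes. *)

(** * The Euclidean norm *)

(** [Q] and [tau0] are fixed before the dimension, the energy, the initial vectors and the solution,
    so every bound entering them is explicit in [k], [L], [T], [beta], [gamma] and [rho], the norm
    of the initial point. The one bound obtained by compactness, used for orthonormality, leaves no
    trace in the result. Assumption A states neither the symmetry of J nor a bound on it, and [hess]
    is only a matrix of iterated partial derivatives. Symmetry is proved from second differences of
    E, the bound from difference quotients of F. The field for x contains F, which may be unbounded,
    and no a priori bound on the iterates x_n is at hand. The Lipschitz estimate for this field is
    therefore asymmetric: it uses the size of F at the first state only, which is always taken on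
    the exact solution. No second time derivative is used: consistency comes from a mean value
    inequality and the Lipschitz bounds on the fields. *)

Section Euclidean.
Set Implicit Arguments.
Unset Strict Implicit.
Context {R : realType} {N : nat}.
Implicit Types (u v w : 'cV[R]_N) (a c : R).

Lemma dotE u v : dot u v = \sum_i u i 0 * v i 0.
Proof. by rewrite /dot mxE; apply: eq_bigr => i _; rewrite mxE. Qed.

Lemma dotC u v : dot u v = dot v u.
Proof. by rewrite !dotE; apply: eq_bigr => i _; rewrite mulrC. Qed.

Lemma dotDl u v w : dot (u + v) w = dot u w + dot v w.
Proof. by rewrite /dot linearD mulmxDl mxE. Qed.

Lemma dotZl a u v : dot (a *: u) v = a * dot u v.
Proof. by rewrite /dot linearZ -scalemxAl mxE. Qed.

Lemma dotNl u v : dot (- u) v = - dot u v.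
Proof. by rewrite -scaleN1r dotZl mulN1r. Qed.

Lemma dotBl u v w : dot (u - v) w = dot u w - dot v w.
Proof. by rewrite dotDl dotNl. Qed.

Lemma dot0l u : dot 0 u = 0.
Proof. by rewrite -(scale0r 0) dotZl mul0r. Qed.

Lemma dotDr u v w : dot w (u + v) = dot w u + dot w v.
Proof. by rewrite !(dotC w) dotDl. Qed.

Lemma dotZr a u v : dot v (a *: u) = a * dot v u.
Proof. by rewrite !(dotC v) dotZl. Qed.

Lemma dotBr u v w : dot w (u - v) = dot w u - dot w v.
Proof. by rewrite !(dotC w) dotBl. Qed.

Lemma dot_suml I (r : seq I) (P : pred I) (F : I -> 'cV[R]_N) w :
  dot (\sum_(i <- r | P i) F i) w = \sum_(i <- r | P i) dot (F i) w.
Proof.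
exact: (big_morph (fun u => dot u w) (fun u v => dotDl u v w) (dot0l w)).
Qed.

Lemma mulmx_outer v w : v *m v^T *m w = dot v w *: v.
Proof. by rewrite -mulmxA [v^T *m w]mx11_scalar mul_mx_scalar. Qed.

Lemma dot_ge0 u : 0 <= dot u u.
Proof. by rewrite dotE sumr_ge0 // => i _; rewrite -expr2 sqr_ge0. Qed.

Lemma dot_eq0 u : dot u u = 0 -> u = 0.
Proof.
rewrite dotE => /psumr_eq0P u0; apply/matrixP => i j; rewrite ord1 mxE.
have /eqP := u0 (fun i _ => sqr_ge0 (u i 0)) i isT.
by rewrite mulf_eq0 orbb => /eqP.
Qed.

Lemma norm2_ge0 u : 0 <= norm2 u.
Proof. exact: sqrtr_ge0. Qed.

Lemma norm2_sqr u : norm2 u ^+ 2 = dot u u.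
Proof. by rewrite sqr_sqrtr ?dot_ge0. Qed.

Lemma norm2_0 : norm2 (0 : 'cV[R]_N) = 0.
Proof. by rewrite /norm2 dot0l sqrtr0. Qed.

Lemma norm2_eq0 u : norm2 u = 0 -> u = 0.
Proof. by move=> u0; apply: dot_eq0; rewrite -norm2_sqr u0 expr0n. Qed.

Lemma norm2Z a u : norm2 (a *: u) = `|a| * norm2 u.
Proof.
by rewrite /norm2 dotZl dotZr mulrA -expr2 sqrtrM ?sqr_ge0 // sqrtr_sqr.
Qed.

Lemma norm2N u : norm2 (- u) = norm2 u.
Proof. by rewrite -scaleN1r norm2Z normrN1 mul1r. Qed.

Lemma norm2BC u v : norm2 (u - v) = norm2 (v - u).
Proof. by rewrite -norm2N opprB. Qed.

(** Cauchy-Schwarz, from expanding the square of [norm2 v *: u - norm2 u *: v]. Zero vectors are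
    treated apart because the product of the norms is cancelled at the end. *)
Lemma dot_le_norm2 u v : dot u v <= norm2 u * norm2 v.
Proof.
have [u0|u_neq0] := eqVneq (norm2 u) 0.
  by rewrite u0 (norm2_eq0 u0) dot0l mul0r.
have [v0|v_neq0] := eqVneq (norm2 v) 0.
  by rewrite v0 (norm2_eq0 v0) dotC dot0l mulr0.
have p_gt0 : 0 < norm2 u by rewrite lt_def u_neq0 norm2_ge0.
have q_gt0 : 0 < norm2 v by rewrite lt_def v_neq0 norm2_ge0.
have := dot_ge0 (norm2 v *: u - norm2 u *: v).
rewrite !(dotBl, dotBr, dotZl, dotZr) (dotC v u) -!norm2_sqr => H.
have : 0 <= (norm2 u * norm2 v) * (norm2 u * norm2 v - dot u v) by nra.
by rewrite pmulr_rge0 ?mulr_gt0 // subr_ge0.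
Qed.

Lemma normr_dot_le u v : `|dot u v| <= norm2 u * norm2 v.
Proof.
rewrite ler_norml dot_le_norm2 andbT lerNl -dotNl.
by rewrite (le_trans (dot_le_norm2 _ _)) // norm2N.
Qed.

Lemma norm2D u v : norm2 (u + v) <= norm2 u + norm2 v.
Proof.
rewrite -(ler_pXn2r (ltn0Sn 1)) ?nnegrE ?addr_ge0 ?norm2_ge0 //.
rewrite norm2_sqr dotDl !dotDr (dotC v u) -!norm2_sqr.
have := dot_le_norm2 u v; nra.
Qed.

Lemma norm2B u v : norm2 (u - v) <= norm2 u + norm2 v.
Proof. by rewrite (le_trans (norm2D _ _)) // norm2N. Qed.

Lemma norm2_le_add u v w : norm2 (u - w) <= norm2 (u - v) + norm2 (v - w).
Proof. by rewrite (le_trans _ (norm2D _ _)) // addrA subrK. Qed.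

Lemma norm2_le_dist u v : norm2 u <= norm2 v + norm2 (u - v).
Proof. by rewrite (le_trans _ (norm2D _ _)) // addrC subrK. Qed.

Lemma norm2_sum I (r : seq I) (P : pred I) (F : I -> 'cV[R]_N) :
  norm2 (\sum_(i <- r | P i) F i) <= \sum_(i <- r | P i) norm2 (F i).
Proof.
elim/big_ind2: _ => [|u a v b ua vb|//]; first by rewrite norm2_0.
by rewrite (le_trans (norm2D _ _)) // lerD.
Qed.

(** Turns scalar estimates into norm estimates: a bound on [dot u w] for every [w] is applied to
    [w := u], then divided by [norm2 u]. *)
Lemma norm2_le_of_dot u c : dot u u <= c * norm2 u -> 0 <= c -> norm2 u <= c.
Proof.
have [->//|u_neq0] := eqVneq (norm2 u) 0.
rewrite -norm2_sqr expr2 ler_pM2r // lt_def u_neq0; exact: norm2_ge0.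
Qed.

Lemma norm2_unit u : dot u u = 1 -> norm2 u = 1.
Proof. by rewrite /norm2 => ->; rewrite sqrtr1. Qed.

(** Triangle inequality over the columns. The constant is crude; only its existence matters, so that
    the supremum defining [mxnorm2] is a genuine one. *)
Lemma mulmx_norm2_bounded (A : 'M[R]_N) :
  exists c, forall u, norm2 (A *m u) <= c * norm2 u.
Proof.
exists (\sum_j norm2 (col j A)) => u.
have -> : A *m u = \sum_j u j 0 *: col j A.
  apply/matrixP => i j; rewrite mxE summxE ord1.
  by apply: eq_bigr => l _; rewrite !mxE mulrC.
apply: (le_trans (norm2_sum _ _ _)); rewrite mulr_suml; apply: ler_sum => j _.
rewrite norm2Z mulrC ler_wpM2l ?norm2_ge0 // -sqrtr_sqr ler_sqrt ?dot_ge0 //.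
by rewrite dotE (bigD1 j) //= expr2 lerDl sumr_ge0 // => i _; rewrite -expr2 sqr_ge0.
Qed.

Lemma mxnorm2_has_sup (A : 'M[R]_N) :
  has_sup [set norm2 (A *m u) | u in [set u : 'cV[R]_N | norm2 u <= 1]].
Proof.
split; first by exists (norm2 (A *m 0)), 0 => //=; rewrite norm2_0.
have [c cP] := mulmx_norm2_bounded A; exists `|c| => _ [u u1 <-].
rewrite (le_trans (cP u)) // (le_trans (ler_wpM2r _ (ler_norm c))) ?norm2_ge0 //.
by rewrite ler_piMr.
Qed.

Lemma mxnorm2_ge0 (A : 'M[R]_N) : 0 <= mxnorm2 A.
Proof.
apply: ub_le_sup; first by have [] := mxnorm2_has_sup A.
by exists 0; rewrite /= ?mulmx0 norm2_0.
Qed.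

Lemma norm2_mulmx (A : 'M[R]_N) u : norm2 (A *m u) <= mxnorm2 A * norm2 u.
Proof.
have [u0|u_neq0] := eqVneq (norm2 u) 0.
  by rewrite u0 mulr0 (norm2_eq0 u0) mulmx0 norm2_0.
have u_gt0 : 0 < norm2 u by rewrite lt_def u_neq0 norm2_ge0.
rewrite -ler_pdivrMr //; apply: ub_le_sup; first by have [] := mxnorm2_has_sup A.
exists ((norm2 u)^-1 *: u) => /=.
  by rewrite norm2Z ger0_norm ?invr_ge0 ?norm2_ge0 // mulVf.
by rewrite -scalemxAr norm2Z ger0_norm ?invr_ge0 ?norm2_ge0 // mulrC.
Qed.

End Euclidean.

(** * Curves in Euclidean space *)

Section Calculus.
Set Implicit Arguments.
Unset Strict Implicit.
Context {R : realType}.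

Lemma is_derive_coord (V : normedModType R) N (y : V -> 'cV[R]_N) (dy : 'cV[R]_N)
    t d i :
  is_derive t d y dy -> is_derive t d (fun s => y s i 0) (dy i 0).
Proof.
case=> y_derivable <-; have yi := (derivable_mxP y t d).1 y_derivable i 0.
by apply: DeriveDef => //; rewrite derive_mx // mxE.
Qed.

Lemma is_derive_dot (V : normedModType R) N (y z : V -> 'cV[R]_N)
    (dy dz : 'cV[R]_N) t d :
  is_derive t d y dy -> is_derive t d z dz ->
  is_derive t d (fun s => dot (y s) (z s)) (dot dy (z t) + dot (y t) dz).
Proof.
move=> dyP dzP.
have -> : (fun s => dot (y s) (z s)) =
    \sum_(i < N) ((fun s => y s i 0) * (fun s => z s i 0)).
  by apply/funext => s; rewrite dotE fct_sumE.
apply: is_derive_eq.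
  by apply: is_derive_sum => i; apply: is_deriveM; apply: is_derive_coord.
rewrite !dotE -big_split /=; apply: eq_bigr => i _.
by rewrite addrC; congr (_ + _); apply: mulrC.
Qed.

Lemma within_continuous_sum n (F : 'I_n -> R -> R) (A : set R) :
  (forall i, {within A, continuous (F i)}) ->
  {within A, continuous (fun s => \sum_(i < n) F i s)}.
Proof.
move=> Fc s; apply: cvg_big => [|i _]; first exact: add_continuous.
exact: Fc.
Qed.

Lemma within_continuous_dot N (y z : R -> 'cV[R]_N) (A : set R) :
  {within A, continuous y} -> {within A, continuous z} ->
  {within A, continuous (fun s => dot (y s) (z s))}.
Proof.
move=> yc zc.
have coordc (w : R -> 'cV[R]_N) i : {within A, continuous w} ->
    {within A, continuous (fun s => w s i 0)}.
  move=> wc s; apply: (@continuous_comp _ _ _ (w : subspace A -> _)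
    (fun M : 'cV[R]_N => M i 0)); [exact: wc | exact: coord_continuous].
have -> : (fun s => dot (y s) (z s)) = (fun s => \sum_(i < N) y s i 0 * z s i 0).
  by apply/funext => s; rewrite dotE.
by apply: within_continuous_sum => i s; apply: cvgM; apply: coordc.
Qed.

(** The mean value theorem fails for vector-valued curves, so it is applied to [dot u (y s)], where
    [u] is the very vector to be estimated. With [c = 0] this bounds displacements; with [c] the
    initial slope it gives second-order consistency. *)
Lemma mean_value_norm2 N (y dy : R -> 'cV[R]_N) (c : 'cV[R]_N) (a b K : R) :
  a <= b -> 0 <= K -> {within `[a, b], continuous y} ->
  (forall s, a < s < b -> is_derive s 1 y (dy s)) ->
  (forall s, a < s < b -> norm2 (dy s - c) <= K) ->
  norm2 (y b - y a - (b - a) *: c) <= K * (b - a).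
Proof.
rewrite le_eqVlt => /predU1P[->|ab] K0 yc dyP dyK.
  by rewrite !subrr scale0r subr0 norm2_0 mulr0.
set u := _ - _ *: c.
have [||s s_ab us] := @MVT R (fun s => dot u (y s)) (fun s => dot u (dy s)) a b ab.
- move=> s; rewrite in_itv /= => /dyP ds.
  by apply: is_derive_eq (is_derive_dot (is_derive_cst u s 1) ds) _;
    rewrite dot0l add0r.
- by apply: within_continuous_dot => //; exact: cst_continuous.
apply: norm2_le_of_dot; last by rewrite mulr_ge0 // subr_ge0 ltW.
rewrite {1}/u dotC !dotBr dotZr us [_ * (b - a)]mulrC -mulrBr -dotBr mulrAC mulrC.
rewrite ler_wpM2r ?subr_ge0 ?(ltW ab) // (le_trans (dot_le_norm2 _ _)) // mulrC.
by rewrite ler_wpM2r ?norm2_ge0 //; apply: dyK; move: s_ab; rewrite in_itv.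
Qed.

(** The product of [f s] and [expR (- C * s)] has a nonpositive derivative inside the interval,
    hence is nonincreasing up to its ends by continuity. *)
Lemma gronwall (f df : R -> R) (T C : R) :
  {within `[0, T], continuous f} ->
  (forall s, 0 < s < T -> is_derive s 1 f (df s)) ->
  (forall s, 0 < s < T -> df s <= C * f s) ->
  forall t, 0 <= t <= T -> f t <= f 0 * expR (C * t).
Proof.
move=> fc dfP dfC t /andP[t0 tT].
pose h s := f s * expR (- C * s).
have expP s : is_derive s (1 : R) (fun s : R => expR (- C * s)) (expR (- C * s) * - C).
  apply: (@is_derive1_comp _ expR (fun s => - C * s)).
  by apply: is_derive_eq (is_deriveZ _ _) _; rewrite [_ *: _]mulr1.
have hP s : 0 < s < T -> is_derive s 1 h (expR (- C * s) * (df s - C * f s)).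
  move=> /dfP ds; apply: is_derive_eq (is_deriveM ds (expP s)) _.
  by rewrite /GRing.scale /=; ring.
suff : h t <= h 0.
  rewrite /h mulr0 expR0 mulr1 => ht.
  by rewrite -ler_pdivrMr ?expR_gt0 // -expRN -mulNr.
apply: (@ler0_derive1_nincr _ h 0 T) => //.
- by move=> s; rewrite in_itv /= => /hP[].
- move=> s; rewrite in_itv /= => sT; have := hP s sT => -[_ hs].
  rewrite derive1E hs pmulr_rle0 ?expR_gt0 // subr_le0; exact: dfC.
- move=> s; apply: cvgM; first exact: fc.
  apply: continuous_subspaceT => {}s; apply: differentiable_continuous.
  by apply/derivable1_diffP; have [] := expP s.
Qed.

End Calculus.

(** Stands in for passing to the limit as [h] tends to 0. For a margin [e] the choice
    [h = e / (c + 1)] also covers [c = 0]. *)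
Lemma le_of_forall_le_linear (R : realFieldType) (a b c : R) :
  0 <= c -> (forall h, 0 < h -> a <= b + c * h) -> a <= b.
Proof.
move=> c0 ab; apply/ler_addgt0Pr => e e0.
have c1 : 0 < c + 1 by rewrite ltr_wpDl.
rewrite (le_trans (ab (e / (c + 1)) _)) ?divr_gt0 // lerD2l mulrCA ger_pMr //.
by rewrite ler_pdivrMr // mul1r lerDl.
Qed.

(** * Second derivatives of the energy *)

Section Potential.
Set Implicit Arguments.
Unset Strict Implicit.
Context {R : realType} {N : nat}.
Implicit Types (a b x : 'cV[R]_N).

(** Fréchet differentiability makes the directional derivative linear in the direction; this links
    [grad] and [hess], defined by partial derivatives, to derivatives along arbitrary lines. *)
Lemma derive_delta_mx (f : 'cV[R]_N -> R) x a : differentiable f x ->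
  'D_a f x = \sum_j a j 0 * 'D_(delta_mx j 0) f x.
Proof.
move=> fx; rewrite deriveE // {1}(matrix_sum_delta a) linear_sum.
apply: eq_bigr => j _; rewrite big_ord1 linearZ deriveE //.
Qed.

Lemma is_derive_line (f : 'cV[R]_N -> R) x a (s : R) :
  differentiable f (x + s *: a) ->
  is_derive s 1 (fun r => f (x + r *: a)) ('D_a f (x + s *: a)).
Proof.
move=> fx; have fa : derivable f (x + s *: a) a by exact: diff_derivable.
have quotE : (fun h : R => h^-1 *: (f (x + (h *: 1 + s) *: a) - f (x + s *: a)))
    = (fun h => h^-1 *: (f (h *: a + (x + s *: a)) - f (x + s *: a))).
  apply/funext => h; congr (_ *: (f _ - _)).
  by rewrite [h *: 1]mulr1 scalerDl addrCA.
by apply: DeriveDef; rewrite /derivable /derive /= quotE.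
Qed.

Context (E : 'cV[R]_N -> R) (L : R).
Hypotheses (E_diff : twice_differentiable E) (E_lip : assumptionA E L).

Lemma is_derive_energy_line x a (s : R) :
  is_derive s 1 (fun r => E (x + r *: a)) (- dot (force E (x + s *: a)) a).
Proof.
have [Ex _] := E_diff (x + s *: a).
apply: is_derive_eq (is_derive_line Ex) _.
rewrite derive_delta_mx // dotNl opprK dotE; apply: eq_bigr => j _.
by rewrite mxE mulrC.
Qed.

Lemma is_derive_force_line x a b (s : R) :
  is_derive s 1 (fun r => dot (force E (x + r *: a)) b)
    (dot (force_jac E (x + s *: a) *m a) b).
Proof.
have [_ Gx] := E_diff (x + s *: a).
have giP i : is_derive s 1 (fun r => - b i 0 * grad E (x + r *: a) i 0)
    (- b i 0 * (hess E (x + s *: a) *m a) i 0).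
  have gi : differentiable (fun y => grad E y i 0) (x + s *: a).
    apply: (@differentiable_comp _ _ _ _ (grad E) (fun M : 'cV[R]_N => M i 0)) => //.
    exact: differentiable_coord.
  apply: is_deriveZ; apply: is_derive_eq (is_derive_line gi) _.
  by rewrite derive_delta_mx // !mxE; apply: eq_bigr => j _; rewrite mxE mulrC.
have -> : (fun r => dot (force E (x + r *: a)) b) =
    \sum_(i < N) (fun r => - b i 0 * grad E (x + r *: a) i 0).
  apply/funext => r; rewrite dotE fct_sumE; apply: eq_bigr => i _.
  by rewrite !mxE; ring.
apply: is_derive_eq (is_derive_sum giP) _.
rewrite dotE; apply: eq_bigr => i _.
by rewrite mulNmx [in RHS]mxE; ring.
Qed.

Lemma force_lipschitz x1 x2 :
  norm2 (force E x2 - force E x1) <= L * norm2 (x2 - x1).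
Proof. by rewrite (le_trans _ (E_lip.1 x1 x2)) // lerDr mxnorm2_ge0. Qed.

Lemma force_jac_lipschitz x1 x2 a :
  norm2 (force_jac E x2 *m a - force_jac E x1 *m a) <=
  L * norm2 (x2 - x1) * norm2 a.
Proof.
rewrite -mulmxBl (le_trans (norm2_mulmx _ _)) // ler_wpM2r ?norm2_ge0 //.
by rewrite (le_trans _ (E_lip.1 x1 x2)) // lerDl norm2_ge0.
Qed.

Hypothesis L_ge0 : 0 <= L.

Lemma dot_force_jac_lipschitz x1 x2 a b :
  dot (force_jac E x2 *m a) b <=
  dot (force_jac E x1 *m a) b + L * norm2 (x2 - x1) * norm2 a * norm2 b.
Proof.
rewrite -lerBlDl -dotBl (le_trans (dot_le_norm2 _ _)) //.
by rewrite ler_wpM2r ?norm2_ge0 // force_jac_lipschitz.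
Qed.

Lemma force_mean_value x a b (h : R) : 0 < h ->
  exists2 s, 0 < s < h &
    dot (force E (x + h *: a)) b - dot (force E x) b =
    h * dot (force_jac E (x + s *: a) *m a) b.
Proof.
move=> h0.
have [||s s_h] := @MVT R (fun r => dot (force E (x + r *: a)) b)
  (fun r => dot (force_jac E (x + r *: a) *m a) b) 0 h h0.
- by move=> s _; exact: is_derive_force_line.
- apply: derivable_within_continuous => s _.
  by have [] := is_derive_force_line x a b s.
rewrite scale0r addr0 subr0 mulrC => fs; by exists s.
Qed.

(** The Lipschitz bound on F controls its difference quotients, which equal J at an intermediate
    point of the segment of length [h] times [norm2 a]. Moving J back to [x] costs O(h), and [h]
    tends to 0. *)
Lemma dot_force_jac_le x a b :
  dot (force_jac E x *m a) b <= L * norm2 a * norm2 b.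
Proof.
have p0 := norm2_ge0 a; have q0 := norm2_ge0 b.
apply: (@le_of_forall_le_linear _ _ _ (L * norm2 a * norm2 a * norm2 b)) => [|h h0].
  by rewrite !mulr_ge0.
have [s /andP[s0 sh] Fs] := force_mean_value x a b h0.
have addK' (u : 'cV[R]_N) : x + u - x = u by rewrite addrC addKr.
apply: (le_trans (dot_force_jac_lipschitz (x + s *: a) x a b)).
rewrite (norm2BC x) addK' norm2Z (gtr0_norm s0) lerD //.
  rewrite -(ler_pM2l h0) -Fs -dotBl (le_trans (dot_le_norm2 _ _)) //.
  rewrite mulrA ler_wpM2r // (le_trans (force_lipschitz _ _)) //.
  by rewrite addK' norm2Z (gtr0_norm h0) mulrCA.
rewrite (_ : L * _ * _ * _ = L * norm2 a * norm2 a * norm2 b * s); last by ring.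
by rewrite ler_wpM2l ?(ltW sh) // !mulr_ge0.
Qed.

Lemma norm2_force_jac x a : norm2 (force_jac E x *m a) <= L * norm2 a.
Proof.
by apply: norm2_le_of_dot; [exact: dot_force_jac_le | rewrite mulr_ge0 ?norm2_ge0].
Qed.

(* The second difference of E is computed by the mean value theorem in one
   direction, then in the other. *)
Lemma energy_second_difference x a b (h : R) : 0 < h ->
  exists2 y, norm2 (y - x) <= h * (norm2 a + norm2 b) &
    E (x + h *: a + h *: b) - E (x + h *: a) - E (x + h *: b) + E x =
    - (h ^+ 2 * dot (force_jac E y *m b) a).
Proof.
move=> h0.
have dP (s : R) : is_derive s 1
    ((fun r => E (x + h *: b + r *: a)) - (fun r => E (x + r *: a)))
    (- dot (force E (x + h *: b + s *: a)) a + dot (force E (x + s *: a)) a).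
  apply: is_derive_eq (is_deriveB (is_derive_energy_line _ _ _)
    (is_derive_energy_line _ _ _)) _.
  by rewrite opprK.
have [|s s_h Es] := @MVT R _ _ 0 h h0 (fun s _ => dP s).
  by apply: derivable_within_continuous => s _; have [] := dP s.
have {s_h} /andP[s0 sh] : 0 < s < h by move: s_h; rewrite in_itv.
have [r /andP[r0 rh] Fr] := force_mean_value (x + s *: a) b a h0.
exists (x + s *: a + r *: b).
  rewrite [X in norm2 X](_ : _ = s *: a + r *: b); last first.
    by rewrite addrC !addrA addNr add0r.
  rewrite (le_trans (norm2D _ _)) // !norm2Z (gtr0_norm s0) (gtr0_norm r0) mulrDr.
  by rewrite lerD // ler_wpM2r ?norm2_ge0 // ltW.
move: Es; rewrite /= !fctE scale0r !addr0 subr0 => Es.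
rewrite (addrAC x (s *: a)) in Fr.
rewrite expr2 -mulrA -Fr (addrAC x (h *: a)).
by apply: (etrans _ (etrans Es _)); ring.
Qed.

(** Schwarz's theorem. The second difference of E is symmetric in [a] and [b], so the two ways of
    computing it equate the two forms, but at distinct points [y] and [z]. Both lie within O(h) of
    [x], and J is Lipschitz. *)
Lemma force_jac_sym x a b :
  dot (force_jac E x *m a) b = dot (force_jac E x *m b) a.
Proof.
wlog suff : a b / dot (force_jac E x *m a) b <= dot (force_jac E x *m b) a.
  by move=> sym; apply: le_anti; rewrite !sym.
pose c := L * (norm2 a + norm2 b) * norm2 a * norm2 b.
apply: (@le_of_forall_le_linear _ _ _ (c + c)) => [|h h0].
  by rewrite addr_ge0 // !mulr_ge0 ?addr_ge0 ?norm2_ge0.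
have [y yx Ey] := energy_second_difference x a b h0.
have [z zx Ez] := energy_second_difference x b a h0.
have yz : dot (force_jac E y *m b) a = dot (force_jac E z *m a) b.
  have h2 : h ^+ 2 != 0 by rewrite expf_neq0 // gt_eqF.
  apply: (mulfI h2); apply: oppr_inj; rewrite -Ey -Ez (addrAC x); ring.
have close w (u v : 'cV[R]_N) : norm2 (w - x) <= h * (norm2 a + norm2 b) ->
    L * norm2 (w - x) * norm2 u * norm2 v <=
    L * (norm2 a + norm2 b) * norm2 u * norm2 v * h.
  move=> wx; rewrite [leRHS]mulrC !mulrA !ler_wpM2r ?norm2_ge0 //.
  by rewrite [h * L]mulrC -mulrA ler_wpM2l.
have := dot_force_jac_lipschitz z x a b.
rewrite (norm2BC x); move/le_trans; apply; rewrite mulrDl addrA lerD //; last first.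
  by apply: close; rewrite (addrC (norm2 a)).
rewrite -yz; apply: (le_trans (dot_force_jac_lipschitz x y b a)); rewrite lerD2l.
by rewrite (le_trans (close _ _ _ yx)) // (mulrAC _ (norm2 b) (norm2 a)).
Qed.

End Potential.

(** * Stability of Gram-Schmidt *)

Section GramSchmidt.
Set Implicit Arguments.
Unset Strict Implicit.
Context {R : realType} {N k : nat}.
Implicit Types (vt v : 'I_k -> 'cV[R]_N).

Lemma dot_gs_residual vt v (i l : 'I_k) :
  (forall j m : 'I_k, (j < i)%N -> (m < i)%N -> dot (v j) (v m) = (j == m)%:R) ->
  (l < i)%N -> dot (gs_residual vt v i) (v l) = 0.
Proof.
move=> vP li; rewrite /gs_residual dotBl dot_suml (bigD1 l) //= dotZl vP // eqxx.
rewrite mulr1 big1 ?addr0 ?subrr // => j /andP[ji jl].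
by rewrite dotZl vP // (negPf jl) mulr0.
Qed.

(** The difference of squares factors through [norm2 u + 1], which is at least 1. *)
Lemma normr_norm2_sub1 (u : 'cV[R]_N) (e : R) :
  `|dot u u - 1| <= e -> `|norm2 u - 1| <= e.
Proof.
rewrite -norm2_sqr !ler_norml; have := norm2_ge0 u.
by move=> u0 /andP[? ?]; apply/andP; split; nra.
Qed.

Lemma norm2_normalize_sub (w : 'cV[R]_N) : norm2 w != 0 ->
  norm2 ((norm2 w)^-1 *: w - w) = `|norm2 w - 1|.
Proof.
move=> w0; rewrite -{3}[w]scale1r -scalerBl norm2Z -[X in _ * X]ger0_norm ?norm2_ge0 //.
by rewrite -normrM mulrBl mulVf // mul1r distrC.
Qed.

(** The powers of 7 solve the error recursion: the i-th error is at most [e] plus 6 times the sum of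
    the earlier bounds. The smallness condition keeps every residual away from 0, so that
    normalisation is never degenerate. *)
Lemma gram_schmidt_perturbation vt v (e : R) :
  (forall i j, `|dot (vt i) (vt j) - (i == j)%:R| <= e) ->
  7 ^+ k * e <= 2^-1 ->
  (forall i, v i = (norm2 (gs_residual vt v i))^-1 *: gs_residual vt v i) ->
  orthonormal_family v /\ forall i, norm2 (v i - vt i) <= 7 ^+ k * e.
Proof.
move=> vtP e_small vE.
(* The sign of [e] is known only from the hypothesis at some index, hence the separate case of an
   empty family. *)
have [k0|k_gt0] := posnP k.
  by split=> [i j|i]; have := ltn_ord i; rewrite [X in (_ < X)%N]k0.
have e0 : 0 <= e.
  by rewrite (le_trans _ (vtP (Ordinal k_gt0) (Ordinal k_gt0))).
have seven_le (i j : nat) : (i <= j)%N -> 7 ^+ i * e <= 7 ^+ j * e.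
  by move=> ij; rewrite ler_wpM2r // ler_weXn2l // ler1n.
have claim (n : nat) (i : 'I_k) : (i < n)%N ->
  [/\ dot (v i) (v i) = 1, forall j : 'I_k, (j < i)%N -> dot (v i) (v j) = 0 &
      norm2 (v i - vt i) <= 7 ^+ i * e].
  elim: n i => // n IH i; rewrite ltnS => i_n.
  have ortho (j m : 'I_k) : (j < i)%N -> (m < i)%N -> dot (v j) (v m) = (j == m)%:R.
    move=> ji mi; have [vj vjlt _] := IH j (leq_trans ji i_n).
    have [_ vmlt _] := IH m (leq_trans mi i_n).
    have [->|jm] := eqVneq j m; first by have [] := IH m (leq_trans mi i_n).
    move: (jm); rewrite -val_eqE neq_ltn => /orP[/vmlt|/vjlt //].
    by rewrite dotC.
  (* [r] is the projection that Gram-Schmidt removes from [vt i]. *)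
  set w := gs_residual vt v i; set r := vt i - w.
  have vt1 := normr_norm2_sub1 _; have {vt1} := vt1 (vt i) e.
  have := vtP i i; rewrite eqxx => /[swap]/[apply] vt1.
  have e1 : e <= 2^-1.
    by rewrite (le_trans _ e_small) // (le_trans _ (seven_le 0%N k _)) // mul1r.
  have vt2 : norm2 (vt i) <= 2 by move: vt1; rewrite ler_norml => /andP[_]; lra.
  have r_le : 6 * e * (\sum_(j < k | (j < i)%N) 7 ^+ j) + e = 7 ^+ i * e.
    have -> : \sum_(j < k | (j < i)%N) 7 ^+ j = \sum_(j < i) 7 ^+ j :> R.
      by rewrite (big_ord_widen k (fun j => 7 ^+ j)) // ltnW.
    have := subrX1 (7 : R) i; set S := \sum_(j < i) _ => S7.
    have -> : 7 ^+ i = 6 * S + 1 :> R by lra.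
    by ring.
  (* One [norm2 r] pays for removing the projection, and [e + norm2 r] for normalising the
     residual. *)
  have {}r_le : e + 2 * norm2 r <= 7 ^+ i * e.
    rewrite -r_le addrC lerD2r /r /w /gs_residual opprB addrCA subrr addr0.
    have -> : 6 * e * (\sum_(j < k | (j < i)%N) 7 ^+ j) =
        2 * \sum_(j < k | (j < i)%N) 3 * e * 7 ^+ j by rewrite -mulr_sumr; ring.
    rewrite ler_pM2l //; apply: (le_trans (norm2_sum _ _ _)).
    apply: ler_sum => j ji; have [vj _ vjt] := IH j (leq_trans ji i_n).
    (* Replacing [v j] by [vt j] costs at most 2 times [7 ^+ j * e], and the product with [vt j] is
       at most [e]: together at most [3 * e * 7 ^+ j]. *)
    rewrite norm2Z (norm2_unit vj) mulr1 -(subrK (vt j) (v j)) dotDr.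
    have ij : (i == j) = false by rewrite -val_eqE gtn_eqF.
    have := vtP i j; rewrite ij subr0 => vtij.
    apply: (le_trans (ler_normD _ _)).
    have := le_trans (normr_dot_le (vt i) (v j - vt j))
      (ler_pM (norm2_ge0 _) (norm2_ge0 _) vt2 vjt).
    have := seven_le 0%N j (leq0n _); rewrite expr0 mul1r; lra.
  have i_small : 7 ^+ i * e <= 2^-1 by rewrite (le_trans _ e_small) // seven_le // ltnW.
  have w1 : `|norm2 w - 1| <= e + norm2 r.
    have := norm2_le_dist w (vt i); have := norm2_le_dist (vt i) w.
    rewrite (norm2BC w) -/r; move: vt1; rewrite !ler_norml => /andP[] *.
    by apply/andP; split; lra.
  have r0 := norm2_ge0 r.
  have w_gt0 : 0 < norm2 w by move: w1; rewrite ler_norml => /andP[] *; lra.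
  have w_neq0 : norm2 w != 0 by rewrite gt_eqF.
  split=> [|j ji|].
  - by rewrite vE -/w dotZl dotZr -norm2_sqr expr2 mulKf // mulVf.
  - by rewrite vE -/w dotZl dot_gs_residual // mulr0.
  apply: (le_trans (norm2_le_add _ w _)).
  by rewrite vE -/w norm2_normalize_sub // (norm2BC w) -/r; lra.
split=> [i j|i]; last first.
  by have [_ _ /le_trans] := claim k i (ltn_ord i); apply; rewrite seven_le // ltnW.
have [vi vilt _] := claim k i (ltn_ord i).
have [<-//|] := eqVneq i j; rewrite -val_eqE neq_ltn => /orP[ij|/vilt //].
by have [_ vjlt _] := claim k j (ltn_ord j); rewrite dotC vjlt.
Qed.

End GramSchmidt.

(** * The saddle-dynamics fields *)

Section Fields.
Set Implicit Arguments.
Unset Strict Implicit.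
Context {R : realType} {N k : nat}.
Implicit Types (x : 'cV[R]_N) (v w : 'I_k -> 'cV[R]_N).

Lemma norm2_dot_scale (u f : 'cV[R]_N) :
  norm2 u = 1 -> norm2 (dot u f *: u) <= norm2 f.
Proof.
by move=> u1; rewrite norm2Z u1 mulr1 (le_trans (normr_dot_le _ _)) // u1 mul1r.
Qed.

(** The factors are changed one at a time, [f] last, so that only the size of [f], and not that of
    [f'], enters the bound. *)
Lemma norm2_dot_scale_sub (u u' f f' : 'cV[R]_N) : norm2 u = 1 -> norm2 u' = 1 ->
  norm2 (dot u f *: u - dot u' f' *: u') <=
  2 * norm2 (u - u') * norm2 f + norm2 (f - f').
Proof.
move=> u1 u'1.
have -> : dot u f *: u - dot u' f' *: u' =
    dot (u - u') f *: u + dot u' f *: (u - u') + dot u' (f - f') *: u'.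
  by apply/matrixP => a b; rewrite dotBl dotBr !mxE; ring.
have h1 : norm2 (dot (u - u') f *: u) <= norm2 (u - u') * norm2 f.
  by rewrite norm2Z u1 mulr1 normr_dot_le.
have h2 : norm2 (dot u' f *: (u - u')) <= norm2 (u - u') * norm2 f.
  rewrite norm2Z mulrC ler_wpM2l ?norm2_ge0 // (le_trans (normr_dot_le _ _)) //.
  by rewrite u'1 mul1r.
have h3 := norm2_dot_scale (f - f') u'1.
have := norm2D (dot (u - u') f *: u + dot u' f *: (u - u')) (dot u' (f - f') *: u').
have := norm2D (dot (u - u') f *: u) (dot u' f *: (u - u')); lra.
Qed.

Lemma sumr_le_const (P : pred 'I_k) (F : 'I_k -> R) c :
  0 <= c -> (forall j, P j -> F j <= c) -> \sum_(j < k | P j) F j <= k%:R * c.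
Proof.
move=> c0 Fc; apply: (le_trans (ler_sum _ Fc)).
apply: (@le_trans _ _ (\sum_(j < k) c)); last by rewrite sumr_const card_ord mulr_natl.
by rewrite [leRHS](bigID P) /= lerDl sumr_ge0.
Qed.

Lemma sumr_le_add_const (P : pred 'I_k) (F G : 'I_k -> R) c :
  0 <= c -> (forall j, 0 <= G j) -> (forall j, P j -> F j <= G j + c) ->
  \sum_(j < k | P j) F j <= \sum_(j < k) G j + k%:R * c.
Proof.
move=> c0 G0 FGc; apply: (le_trans (ler_sum _ FGc)); rewrite big_split lerD //=.
  by rewrite [leRHS](bigID P) /= lerDl sumr_ge0.
exact: sumr_le_const.
Qed.

Lemma ler_term_sum (F : 'I_k -> R) i : (forall j, 0 <= F j) -> F i <= \sum_(j < k) F j.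
Proof. by move=> F0; rewrite (bigD1 i) //= lerDl sumr_ge0. Qed.

(** The error of the final estimate, viewed as a distance between two states. *)
Definition state_dist x v x' v' : R :=
  norm2 (x - x') + \sum_(i < k) norm2 (v i - v' i).

Lemma state_dist_ge0 x v x' v' : 0 <= state_dist x v x' v'.
Proof. by rewrite addr_ge0 ?sumr_ge0 ?norm2_ge0 // => i _; rewrite norm2_ge0. Qed.

Lemma norm2_le_state_dist x v x' v' : norm2 (x - x') <= state_dist x v x' v'.
Proof. by rewrite lerDl sumr_ge0 // => i _; rewrite norm2_ge0. Qed.

Lemma sum_le_state_dist x v x' v' :
  \sum_(i < k) norm2 (v i - v' i) <= state_dist x v x' v'.
Proof. by rewrite lerDr norm2_ge0. Qed.

Lemma norm2v_le_state_dist x v x' v' i : norm2 (v i - v' i) <= state_dist x v x' v'.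
Proof.
rewrite (le_trans _ (sum_le_state_dist _ _ _ _)) //.
by apply: (ler_term_sum (F := fun j => norm2 (v j - v' j))) => j; exact: norm2_ge0.
Qed.

Context (E : 'cV[R]_N -> R) (L beta gamma : R).
Hypotheses (E_diff : twice_differentiable E) (E_lip : assumptionA E L).
Hypotheses (L_ge0 : 0 <= L) (beta_ge0 : 0 <= beta) (gamma_ge0 : 0 <= gamma).

Lemma x_fieldE x v : x_field E beta x v =
  beta *: (force E x - 2 *: \sum_(j < k) dot (v j) (force E x) *: v j).
Proof.
rewrite /x_field mulmxBl mul1mx -scalemxAl mulmx_suml.
by under eq_bigr do rewrite mulmx_outer.
Qed.

Lemma v_fieldE x v i : v_field E gamma x v i =
  gamma *: (force_jac E x *m v i - dot (v i) (force_jac E x *m v i) *: v i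
            - 2 *: \sum_(j < k | (j < i)%N) dot (v j) (force_jac E x *m v i) *: v j).
Proof.
rewrite /v_field !mulmxBl mul1mx -scalemxAl mulmx_suml mulmx_outer.
by under eq_bigr do rewrite mulmx_outer.
Qed.

Lemma norm2_x_field x v : (forall i, norm2 (v i) = 1) ->
  norm2 (x_field E beta x v) <= beta * (1 + 2 * k%:R) * norm2 (force E x).
Proof.
move=> v1; rewrite x_fieldE norm2Z ger0_norm // -mulrA ler_wpM2l //.
have sum_le : norm2 (\sum_(j < k) dot (v j) (force E x) *: v j) <=
    k%:R * norm2 (force E x).
  rewrite (le_trans (norm2_sum _ _ _)) // sumr_le_const ?norm2_ge0 // => j _.
  exact: norm2_dot_scale.
by rewrite (le_trans (norm2B _ _)) // norm2Z ger0_norm //; lra.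
Qed.

Lemma norm2_v_field x v i : (forall i, norm2 (v i) = 1) ->
  norm2 (v_field E gamma x v i) <= gamma * (2 + 2 * k%:R) * L.
Proof.
move=> v1; rewrite v_fieldE norm2Z ger0_norm // -mulrA ler_wpM2l //.
set g := force_jac E x *m v i.
have gL : norm2 g <= L by rewrite -[leRHS]mulr1 -(v1 i) norm2_force_jac.
have h1 := norm2_dot_scale g (v1 i).
have h2 : norm2 (\sum_(j < k | (j < i)%N) dot (v j) g *: v j) <= k%:R * L.
  rewrite (le_trans (norm2_sum _ _ _)) // sumr_le_const // => j _.
  by rewrite (le_trans (norm2_dot_scale _ _)).
rewrite (le_trans (norm2B _ _)) // norm2Z ger0_norm //.
have := norm2B g (dot (v i) g *: v i); lra.
Qed.

Lemma x_field_lipschitz x v x' v' B :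
  (forall i, norm2 (v i) = 1) -> (forall i, norm2 (v' i) = 1) ->
  norm2 (force E x) <= B ->
  norm2 (x_field E beta x v - x_field E beta x' v') <=
  beta * ((1 + 2 * k%:R) * L + 4 * B) * state_dist x v x' v'.
Proof.
move=> v1 v'1 FB; rewrite !x_fieldE -scalerBr norm2Z ger0_norm // -mulrA ler_wpM2l //.
have B0 : 0 <= B by exact: le_trans (norm2_ge0 _) FB.
set f := force E x; set f' := force E x'; set d := state_dist x v x' v'.
have fL : norm2 (f - f') <= L * d.
  rewrite (le_trans (force_lipschitz E_lip _ _)) // ler_wpM2l //.
  exact: norm2_le_state_dist.
set S := \sum_j _; set S' := \sum_j _.
have SS' : norm2 (S - S') <= 2 * B * d + k%:R * (L * d).
  rewrite -sumrB (le_trans (norm2_sum _ _ _)) //.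
  apply: (@le_trans _ _ (\sum_(j < k) 2 * B * norm2 (v j - v' j) + k%:R * (L * d))).
    apply: sumr_le_add_const => [|j|j _]; 
      rewrite ?mulr_ge0 ?norm2_ge0 ?state_dist_ge0 //.
    rewrite (le_trans (norm2_dot_scale_sub _ _ _ _)) // lerD // mulrAC.
    by rewrite ler_wpM2r ?norm2_ge0 // ler_wpM2l.
  by rewrite lerD2r -mulr_sumr ler_wpM2l ?mulr_ge0 ?sum_le_state_dist.
have -> : f - 2 *: S - (f' - 2 *: S') = (f - f') - 2 *: (S - S').
  by apply/matrixP => a b; rewrite !mxE; ring.
rewrite (le_trans (norm2B _ _)) // norm2Z ger0_norm //; lra.
Qed.

Lemma reflection_lipschitz v v' (g g' : 'cV[R]_N) i c d :
  (forall i, norm2 (v i) = 1) -> (forall i, norm2 (v' i) = 1) ->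
  norm2 g <= c -> \sum_(j < k) norm2 (v j - v' j) <= d ->
  norm2 (g - dot (v i) g *: v i - 2 *: (\sum_(j < k | (j < i)%N) dot (v j) g *: v j)
         - (g' - dot (v' i) g' *: v' i
            - 2 *: (\sum_(j < k | (j < i)%N) dot (v' j) g' *: v' j))) <=
  (2 + 2 * k%:R) * norm2 (g - g') + 6 * c * d.
Proof.
move=> v1 v'1 gc vd; set P := dot (v i) g *: _; set P' := dot (v' i) g' *: _.
have c0 : 0 <= c by exact: le_trans (norm2_ge0 _) gc.
have vid : norm2 (v i - v' i) <= d.
  rewrite (le_trans _ vd) //.
  by apply: (ler_term_sum (F := fun j => norm2 (v j - v' j))) => j; exact: norm2_ge0.
have PP' : norm2 (P - P') <= 2 * c * d + norm2 (g - g').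
  rewrite (le_trans (norm2_dot_scale_sub _ _ _ _)) // lerD2r.
  have := ler_pM (norm2_ge0 _) (norm2_ge0 _) vid gc; lra.
set S := \sum_(j < k | _) _; set S' := \sum_(j < k | _) _.
have SS' : norm2 (S - S') <= 2 * c * d + k%:R * norm2 (g - g').
  rewrite -sumrB (le_trans (norm2_sum _ _ _)) //.
  apply: (@le_trans _ _ (\sum_(j < k) 2 * c * norm2 (v j - v' j)
                         + k%:R * norm2 (g - g'))).
    apply: sumr_le_add_const => [|j|j _]; rewrite ?mulr_ge0 ?norm2_ge0 //.
    rewrite (le_trans (norm2_dot_scale_sub _ _ _ _)) // lerD // mulrAC.
    by rewrite ler_wpM2r ?norm2_ge0 // ler_wpM2l.
  by rewrite lerD2r -mulr_sumr ler_wpM2l ?mulr_ge0.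
have -> : g - P - 2 *: S - (g' - P' - 2 *: S') =
    (g - g') - (P - P') - 2 *: (S - S').
  by apply/matrixP => a b; rewrite !mxE; ring.
rewrite (le_trans (norm2B _ _)) // norm2Z ger0_norm //.
have := norm2B (g - g') (P - P'); lra.
Qed.

(** Passing through [force_jac E x *m v' i] bounds the change of J(x) v_i by 2 L times the distance.
    The factor [2 + 2 * k%:R] on it, plus 6 L from the moving projections, gives
    [L * (10 + 4 * k%:R)]. *)
Lemma v_field_lipschitz x v x' v' i :
  (forall i, norm2 (v i) = 1) -> (forall i, norm2 (v' i) = 1) ->
  norm2 (v_field E gamma x v i - v_field E gamma x' v' i) <=
  gamma * (L * (10 + 4 * k%:R)) * state_dist x v x' v'.
Proof.
move=> v1 v'1; rewrite !v_fieldE -scalerBr norm2Z ger0_norm // -mulrA ler_wpM2l //.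
have gL : norm2 (force_jac E x *m v i) <= L.
  by rewrite -[leRHS]mulr1 -(v1 i) norm2_force_jac.
apply: (le_trans (reflection_lipschitz _ _ v1 v'1 gL (sum_le_state_dist x v x' v'))).
have h1 : norm2 (force_jac E x *m v i - force_jac E x *m v' i) <=
    L * state_dist x v x' v'.
  rewrite -mulmxBr (le_trans (norm2_force_jac E_diff E_lip L_ge0 _ _)) //.
  by rewrite ler_wpM2l // norm2v_le_state_dist.
have h2 : norm2 (force_jac E x *m v' i - force_jac E x' *m v' i) <=
    L * state_dist x v x' v'.
  rewrite (le_trans (force_jac_lipschitz E_lip _ _ _)) // v'1 mulr1 ler_wpM2l //.
  exact: norm2_le_state_dist.
move: (le_trans (norm2_le_add _ _ _) (lerD h1 h2)) => {gL h1 h2}.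
move: (norm2 _) (state_dist _ _ _ _) => q d qd.
have k2 : 0 <= 2 + 2 * k%:R :> R by rewrite addr_ge0 ?mulr_ge0.
have := ler_wpM2l k2 qd; lra.
Qed.

Definition gram_defect v (i j : 'I_k) : R := dot (v i) (v j) - (i == j)%:R.

(* The evolution of the Gram matrix is linear in its deviation from the identity;
   this is where the symmetry of the Jacobian is used. *)
Lemma dot_v_field x v i j (a := fun l m => dot (v l) (force_jac E x *m v m)) :
  dot (v_field E gamma x v i) (v j) + dot (v i) (v_field E gamma x v j) =
  - gamma * ((a i i + a j j) * gram_defect v i j
             + 2 * \sum_(l < k | (l < i)%N) a l i * gram_defect v l j
             + 2 * \sum_(l < k | (l < j)%N) a l j * gram_defect v l i).
Proof.
have aC (l m : 'I_k) : a l m = a m l.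
  by rewrite /a dotC (force_jac_sym E_diff E_lip L_ge0) dotC.
(* For distinct [i], [j] exactly one of the two sums produces the extra term; doubled, it cancels
   [a i j + a j i] by symmetry. For [i = j] the projection on [v i] itself does the cancelling. *)
have sumE (m p : 'I_k) : \sum_(l < k | (l < m)%N) a l m * gram_defect v l p =
    \sum_(l < k | (l < m)%N) a l m * dot (v l) (v p) - (p < m)%:R * a p m.
  rewrite /gram_defect; under eq_bigr do rewrite mulrBr.
  rewrite sumrB; congr (_ - _); case: ltnP => pm.
    rewrite (bigD1 p) //= eqxx mulr1 mul1r big1 ?addr0 // => l /andP[_ /negPf ->].
    by rewrite mulr0.
  rewrite mul0r big1 // => l lm; rewrite -val_eqE /= ltn_eqF ?mulr0 //.
  exact: leq_trans pm.
have fieldE (m p : 'I_k) : dot (v_field E gamma x v m) (v p) =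
    gamma * (a p m - a m m * dot (v m) (v p)
             - 2 * \sum_(l < k | (l < m)%N) a l m * dot (v l) (v p)).
  rewrite v_fieldE dotZl !dotBl !dotZl dot_suml (dotC _ (v p)).
  by under eq_bigr do rewrite dotZl.
rewrite [dot (v i) (v_field _ _ _ _ _)]dotC !fieldE !sumE /gram_defect.
rewrite (dotC (v j) (v i)) (aC j i).
clearbody a.
have [<-|] := eqVneq i j; first by rewrite ltnn /=; ring.
by rewrite -val_eqE neq_ltn => /orP[] ij; rewrite ij ltnNge (ltnW ij) /=; ring.
Qed.

Lemma dot_v_field_orthonormal x v i j : orthonormal_family v ->
  dot (v_field E gamma x v i) (v j) + dot (v i) (v_field E gamma x v j) = 0.
Proof.
move=> vP; have gram0 l m : gram_defect v l m = 0 by rewrite /gram_defect vP subrr.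
rewrite dot_v_field gram0 !big1 => [|l _|l _]; rewrite ?gram0 ?mulr0 //; ring.
Qed.

Lemma normr_dot_v_field x v i j A s : 0 <= s ->
  (forall l m, `|dot (v l) (force_jac E x *m v m)| <= A) ->
  (forall l m, `|gram_defect v l m| <= s) ->
  `|dot (v_field E gamma x v i) (v j) + dot (v i) (v_field E gamma x v j)| <=
  gamma * (2 + 4 * k%:R) * A * s.
Proof.
move=> s0 aA gs; rewrite dot_v_field mulNr normrN normrM ger0_norm //.
rewrite -!mulrA ler_wpM2l //.
have A0 : 0 <= A by exact: le_trans (normr_ge0 _) (aA i i).
have prod_le l m p q : `|dot (v l) (force_jac E x *m v m) * gram_defect v p q| <= A * s.
  by rewrite normrM ler_pM.
have sum_le (m p : 'I_k) : `|\sum_(l < k | (l < m)%N)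
    dot (v l) (force_jac E x *m v m) * gram_defect v l p| <= k%:R * (A * s).
  rewrite (le_trans (ler_norm_sum _ _ _)) // sumr_le_const ?mulr_ge0 //.
have combine (p q S S' c d : R) : `|p| <= c -> `|q| <= c -> `|S| <= d -> `|S'| <= d ->
    `|p + q + 2 * S + 2 * S'| <= 2 * c + 4 * d.
  rewrite !ler_norml => /andP[? ?] /andP[? ?] /andP[? ?] /andP[? ?].
  by apply/andP; split; lra.
rewrite mulrDl (le_trans (combine _ _ _ _ _ _ (prod_le _ _ _ _) (prod_le _ _ _ _)
  (sum_le i j) (sum_le j i))) //.
lra.
Qed.

End Fields.

(** * A priori estimates along the flow *)

Section Solution.
Set Implicit Arguments.
Unset Strict Implicit.
Context {R : realType}.

(* A priori bound for [norm2 (force E (x t))] along the solution. *)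
Definition force_bound (k : nat) (L T beta rho : R) : R :=
  L * (1 + (1 + rho ^+ 2) * expR (4 * (beta * (1 + 2 * k%:R) * L) * T)).

(** The bounds for the two fields are added, so that one constant serves all components of the
    state; likewise for [field_lipschitz_const]. *)
Definition speed_bound (k : nat) (L T beta gamma rho : R) : R :=
  beta * (1 + 2 * k%:R) * force_bound k L T beta rho + gamma * (2 + 2 * k%:R) * L.

Definition field_lipschitz_const (k : nat) (L T beta gamma rho : R) : R :=
  beta * ((1 + 2 * k%:R) * L + 4 * force_bound k L T beta rho)
  + gamma * (L * (10 + 4 * k%:R)).

Context {N k : nat} (E : 'cV[R]_N -> R) (L T beta gamma rho : R).
Context (x0 : 'cV[R]_N) (v0 : 'I_k -> 'cV[R]_N).
Context (x : R -> 'cV[R]_N) (v : 'I_k -> R -> 'cV[R]_N).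
Hypotheses (L_ge0 : 0 <= L) (T_ge0 : 0 <= T).
Hypotheses (beta_ge0 : 0 <= beta) (gamma_ge0 : 0 <= gamma).
Hypotheses (E_diff : twice_differentiable E) (E_lip : assumptionA E L).
Hypotheses (x0_norm : norm2 x0 = rho) (v0_orthonormal : orthonormal_family v0).
Hypothesis sol : saddle_solution E beta gamma T x0 v0 x v.

Let xP s : 0 < s < T -> is_derive s 1 x (x_field E beta (x s) (v ^~ s)).
Proof. by have [_ _ + _] := sol; apply. Qed.

Let vP i s : 0 < s < T -> is_derive s 1 (v i) (v_field E gamma (x s) (v ^~ s) i).
Proof. by have [_ _ _] := sol; apply. Qed.

Let xc : {within `[0, T], continuous x}.
Proof. by have [_ [xc _] _ _] := sol. Qed.

Let vc i : {within `[0, T], continuous (v i)}.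
Proof. by have [_ [_ vc] _ _] := sol. Qed.

Arguments xc : clear implicits.
Arguments vc : clear implicits.

(** An explicit bound would need the v_i to be unit vectors, which is not yet known; compactness of
    the time interval suffices. [A] depends on the solution, but only serves in a Gronwall estimate
    starting from 0. *)
Lemma solution_coef_bounded : exists A, forall t, 0 <= t <= T -> forall l m,
  `|dot (v l t) (force_jac E (x t) *m v m t)| <= A.
Proof.
have [|c _ cP] := @EVT_max R (fun t => \sum_(i < k) dot (v i t) (v i t)) 0 T T_ge0.
  by apply: within_continuous_sum => i; exact: within_continuous_dot.
exists (L * \sum_(i < k) dot (v i c) (v i c)) => t tT l m.
rewrite (le_trans (normr_dot_le _ _)) //.
apply: (@le_trans _ _ (L * (norm2 (v l t) * norm2 (v m t)))).
  rewrite mulrCA ler_wpM2l ?norm2_ge0 //; exact: norm2_force_jac.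
rewrite ler_wpM2l // (le_trans _ (cP t _)) //.
have sq_le j : norm2 (v j t) ^+ 2 <= \sum_(i < k) dot (v i t) (v i t).
  rewrite norm2_sqr (ler_term_sum (F := fun i => dot (v i t) (v i t))) // => i.
  exact: dot_ge0.
have := sq_le l; have := sq_le m.
move: (norm2 _) (norm2 _) (\sum_(_ < _) _) => p q S pS qS.
have := sqr_ge0 (p - q); nra.
Qed.

Lemma solution_orthonormal t : 0 <= t <= T -> orthonormal_family (v ^~ t).
Proof.
have [A AP] := solution_coef_bounded.
pose g i j s := gram_defect (v ^~ s) i j.
pose D i j s := dot (v_field E gamma (x s) (v ^~ s) i) (v j s)
                + dot (v i s) (v_field E gamma (x s) (v ^~ s) j).
pose f s := \sum_(i < k) \sum_(j < k) g i j s * g i j s.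
have g_le i j s : `|g i j s| <= Num.sqrt (f s).
  rewrite -sqrtr_sqr ler_wsqrtr // expr2.
  rewrite (le_trans _ (ler_term_sum
    (F := fun i => \sum_(j < k) g i j s * g i j s) i _)) //.
    by apply: (ler_term_sum (F := fun j => g i j s * g i j s)) => j';
      rewrite -expr2 sqr_ge0.
  by move=> i'; apply: sumr_ge0 => j' _; rewrite -expr2 sqr_ge0.
have f_ge0 s : 0 <= f s.
  by apply: sumr_ge0 => i _; apply: sumr_ge0 => j _; rewrite -expr2 sqr_ge0.
have gP i j s : 0 < s < T -> is_derive s 1 (g i j) (D i j s).
  move=> sT; rewrite -[D i j s]subr0.
  exact: is_deriveB (is_derive_dot (vP i sT) (vP j sT)) (is_derive_cst _ _ _).
have fP s : 0 < s < T ->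
    is_derive s 1 f (\sum_(i < k) \sum_(j < k) 2 * (g i j s * D i j s)).
  move=> sT; have -> : f = \sum_(i < k) \sum_(j < k) (g i j * g i j).
    apply/funext => r; rewrite fct_sumE; apply: eq_bigr => i _.
    by rewrite fct_sumE.
  apply: is_derive_sum => i; apply: is_derive_sum => j.
  apply: is_derive_eq (is_deriveM (gP i j s sT) (gP i j s sT)) _.
  by rewrite /GRing.scale /=; ring.
have gc i j : {within `[0, T], continuous (g i j)}.
  have dc := within_continuous_dot (vc i) (vc j).
  move=> s; exact: (cvgB (dc s) (cvg_cst _)).
have fc : {within `[0, T], continuous f}.
  apply: within_continuous_sum => i; apply: within_continuous_sum => j s.
  by apply: cvgM; exact: gc.
pose c := gamma * (2 + 4 * k%:R) * A.
move=> tT.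
(* Each of the k^2 summands of the derivative is at most [2 * c * f s], because [g] is bounded by
   the square root of [f] and [D] by [c] times it. *)
have := gronwall fc fP (C := k%:R * (k%:R * (2 * c))) _ tT.
have -> : f 0 = 0.
  rewrite /f big1 // => i _; rewrite big1 // => j _.
  have [[_ v00] _ _ _] := sol.
  by rewrite /g /gram_defect !v00 v0_orthonormal subrr mul0r.
rewrite mul0r => f_le i j; apply/eqP; rewrite -subr_eq0 -normr_le0.
apply: (le_trans (g_le i j t)); suff /eqP-> : f t == 0 by rewrite sqrtr0.
rewrite eq_le f_ge0 andbT; apply: f_le => s /andP[s0 sT].
have sT' : 0 <= s <= T by rewrite !ltW.
have A0 : 0 <= A by exact: le_trans (normr_ge0 _) (AP s sT' i i).
have c0 : 0 <= c by rewrite !mulr_ge0 ?addr_ge0 ?mulr_ge0.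
have term_le i' j' : 2 * (g i' j' s * D i' j' s) <= 2 * c * f s.
  rewrite -mulrA ler_pM2l // (le_trans (ler_norm _)) // normrM.
  rewrite -[f s]sqr_sqrtr // expr2 mulrCA.
  apply: ler_pM; rewrite // /c.
  apply: (normr_dot_v_field E_diff E_lip L_ge0 gamma_ge0 _ _ (sqrtr_ge0 _)) => l m.
    exact: AP.
  exact: g_le.
have cf0 : 0 <= 2 * c * f s by rewrite !mulr_ge0.
apply: (@le_trans _ _ (k%:R * (k%:R * (2 * c * f s)))); last by rewrite !mulrA.
apply: sumr_le_const => [|i' _]; first exact: mulr_ge0.
by apply: sumr_le_const => // j' _; exact: term_le.
Qed.

Lemma solution_unit t i : 0 <= t <= T -> norm2 (v i t) = 1.
Proof. by move=> /solution_orthonormal tP; rewrite norm2_unit // tP eqxx. Qed.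

(** Gronwall for [dot (x s) (x s) + 1]: the added 1 absorbs the term of first order in the norm,
    since 2 q <= q^2 + 1. *)
Lemma solution_force_bound t : 0 <= t <= T ->
  norm2 (force E (x t)) <= force_bound k L T beta rho.
Proof.
move=> tT; pose K := beta * (1 + 2 * k%:R) * L.
have K0 : 0 <= K by rewrite !mulr_ge0 ?addr_ge0 ?mulr_ge0.
pose f s := dot (x s) (x s) + 1.
have fP s : 0 < s < T ->
    is_derive s 1 f (2 * dot (x s) (x_field E beta (x s) (v ^~ s))).
  move=> sT; apply: is_derive_eq
    (is_deriveD (is_derive_dot (xP sT) (xP sT)) (is_derive_cst (1 : R) s 1)) _.
  by rewrite (dotC _ (x s)) addr0 mulr_natl.
have fc : {within `[0, T], continuous f}.
  have dc := within_continuous_dot xc xc.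
  move=> s; exact: (cvgD (dc s) (cvg_cst _)).
have f_le : f t <= f 0 * expR (4 * K * t).
  apply: gronwall fc fP _ t tT => s /andP[s0 sT].
  have sT' : 0 <= s <= T by rewrite !ltW.
  have := dot_le_norm2 (x s) (x_field E beta (x s) (v ^~ s)).
  have : norm2 (x_field E beta (x s) (v ^~ s)) <= K * (1 + norm2 (x s)).
    apply: (le_trans (norm2_x_field _ beta_ge0 _ (fun i => solution_unit i sT'))).
    rewrite /K -[leRHS]mulrA ler_wpM2l ?mulr_ge0 ?addr_ge0 ?mulr_ge0 //.
    exact: E_lip.2.
  rewrite /f -norm2_sqr; have := norm2_ge0 (x s).
  set p := norm2 (x_field _ _ _ _); set q := norm2 (x s).
  move: (dot _ _) p q => d p q q0 pK dqp.
  have := ler_wpM2l q0 pK.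
  have : 0 <= K * ((q - 1) ^+ 2 + 1) by rewrite mulr_ge0 // addr_ge0 // sqr_ge0.
  have : 0 <= K * q ^+ 2 by rewrite mulr_ge0 // sqr_ge0.
  lra.
apply: (le_trans (E_lip.2 _)); rewrite ler_wpM2l // lerD2l.
have [[x00 _] _ _ _] := sol.
apply: (@le_trans _ _ (f t)).
  rewrite /f -norm2_sqr; have := sqr_ge0 (norm2 (x t) - 1); have := norm2_ge0 (x t).
  by move=> ? ?; nra.
apply: (le_trans f_le); rewrite /f x00 -norm2_sqr x0_norm addrC.
rewrite ler_wpM2l ?addr_ge0 ?sqr_ge0 // ler_expR ler_wpM2l ?mulr_ge0 //.
by have /andP[] := tT.
Qed.

Let B := force_bound k L T beta rho.
Let S := speed_bound k L T beta gamma rho.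
Let Lam := field_lipschitz_const k L T beta gamma rho.

Lemma force_bound_ge0 : 0 <= B.
Proof.
by rewrite mulr_ge0 // addr_ge0 // mulr_ge0 ?expR_ge0 // addr_ge0 ?sqr_ge0.
Qed.

Let affine_ge0 (m n : nat) : 0 <= m%:R + n%:R * k%:R :> R.
Proof. by rewrite addr_ge0 ?mulr_ge0. Qed.

Lemma speed_bound_ge0 : 0 <= S.
Proof.
have B0 := force_bound_ge0; apply: addr_ge0.
  exact: mulr_ge0 (mulr_ge0 beta_ge0 (affine_ge0 1 2)) B0.
exact: mulr_ge0 (mulr_ge0 gamma_ge0 (affine_ge0 2 2)) L_ge0.
Qed.

Let x_lipschitz_ge0 : 0 <= beta * ((1 + 2 * k%:R) * L + 4 * B).
Proof.
have B0 := force_bound_ge0; apply: mulr_ge0 => //.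
by apply: addr_ge0; [exact: mulr_ge0 (affine_ge0 1 2) L_ge0 | exact: mulr_ge0].
Qed.

Let v_lipschitz_ge0 : 0 <= gamma * (L * (10 + 4 * k%:R)).
Proof. exact: mulr_ge0 gamma_ge0 (mulr_ge0 L_ge0 (affine_ge0 10 4)). Qed.

Lemma field_lipschitz_const_ge0 : 0 <= Lam.
Proof. exact: addr_ge0. Qed.

(** The point [y] is arbitrary because the bound is also applied to the iterates of the scheme; only
    the uniform bound on J is involved. *)
Lemma v_speed y (w : 'I_k -> 'cV[R]_N) i : (forall i, norm2 (w i) = 1) ->
  norm2 (v_field E gamma y w i) <= S.
Proof.
move=> w1; apply: (le_trans (norm2_v_field E_diff E_lip L_ge0 gamma_ge0 _ _ w1)).
rewrite lerDr; exact: mulr_ge0 (mulr_ge0 beta_ge0 (affine_ge0 1 2)) force_bound_ge0.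
Qed.

Lemma x_speed t : 0 <= t <= T -> norm2 (x_field E beta (x t) (v ^~ t)) <= S.
Proof.
move=> tT; apply: (le_trans (norm2_x_field _ beta_ge0 _ (fun i => solution_unit i tT))).
apply: ler_wpDr; first exact: mulr_ge0 (mulr_ge0 gamma_ge0 (affine_ge0 2 2)) L_ge0.
by rewrite (ler_wpM2l (mulr_ge0 beta_ge0 (affine_ge0 1 2))) // solution_force_bound.
Qed.

Lemma x_field_lipschitz_solution t y (w : 'I_k -> 'cV[R]_N) :
  0 <= t <= T -> (forall i, norm2 (w i) = 1) ->
  norm2 (x_field E beta (x t) (v ^~ t) - x_field E beta y w) <=
  Lam * state_dist (x t) (v ^~ t) y w.
Proof.
move=> tT w1; apply: (le_trans (x_field_lipschitz E_lip L_ge0 beta_ge0 _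
  (fun i => solution_unit i tT) w1 (solution_force_bound tT))).
by rewrite ler_wpM2r ?state_dist_ge0 // lerDl.
Qed.

Lemma v_field_lipschitz_solution t y (w : 'I_k -> 'cV[R]_N) i :
  0 <= t <= T -> (forall i, norm2 (w i) = 1) ->
  norm2 (v_field E gamma (x t) (v ^~ t) i - v_field E gamma y w i) <=
  Lam * state_dist (x t) (v ^~ t) y w.
Proof.
move=> tT w1; apply: (le_trans (v_field_lipschitz E_diff E_lip L_ge0 gamma_ge0 _ _ _
  (fun i => solution_unit i tT) w1)).
by rewrite ler_wpM2r ?state_dist_ge0 // lerDr.
Qed.

(** * Displacement and consistency over one time step *)

Section Step.
Variables a b : R.
Hypotheses (a_ge0 : 0 <= a) (ab : a <= b) (bT : b <= T).

Let sub_step s : s <= b -> `[a, s] `<=` `[0, T].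
Proof.
move=> sb r /=; rewrite !in_itv /= => /andP[ar rs].
by rewrite (le_trans a_ge0 ar) (le_trans rs (le_trans sb bT)).
Qed.

Let step_in s : a < s < b -> 0 < s < T.
Proof.
by move=> /andP[as_ sb]; rewrite (le_lt_trans a_ge0 as_) (lt_le_trans sb bT).
Qed.

Let step_in_cc s : a < s < b -> 0 <= s <= T.
Proof. by move/step_in => /andP[? ?]; rewrite !ltW. Qed.

Lemma solution_displacement s : a < s < b ->
  state_dist (x s) (v ^~ s) (x a) (v ^~ a) <= (k.+1)%:R * S * (b - a).
Proof.
move=> sab; have /andP[/ltW as_ /ltW sb] := sab.
have displ (y dy : R -> 'cV[R]_N) : {within `[0, T], continuous y} ->
    (forall r, 0 < r < T -> is_derive r 1 y (dy r)) ->
    (forall r, 0 < r < T -> norm2 (dy r) <= S) -> norm2 (y s - y a) <= S * (b - a).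
  move=> yc dyP dyS; apply: (@le_trans _ _ (S * (s - a))); last first.
    by rewrite ler_wpM2l ?speed_bound_ge0 // lerD2r.
  have in_step r : a < r < s -> 0 < r < T.
    by move=> /andP[ar rs]; rewrite step_in // ar (lt_le_trans rs).
  have := @mean_value_norm2 R N y dy 0 a s S as_ speed_bound_ge0.
  rewrite scaler0 subr0; apply=> [|r /in_step|r /in_step rT]; last 2 first.
  - exact: dyP.
  - by rewrite subr0 dyS.
  - exact: continuous_subspaceW (sub_step sb) yc.
have openW r : 0 < r < T -> 0 <= r <= T by move=> /andP[? ?]; rewrite !ltW.
rewrite -natr1 addrC !mulrDl mul1r /state_dist -mulrA; apply: lerD.
  by apply: displ xc xP _ => r /openW; exact: x_speed.
rewrite sumr_le_const ?mulr_ge0 ?subr_ge0 ?speed_bound_ge0 // => i _.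
by apply: displ (vc i) (vP i) _ => r /openW rT;
  apply: v_speed => j; exact: solution_unit.
Qed.

Let defect_ge0 : 0 <= Lam * ((k.+1)%:R * S * (b - a)).
Proof.
by rewrite !mulr_ge0 ?field_lipschitz_const_ge0 ?speed_bound_ge0 ?subr_ge0.
Qed.

Let a_in : 0 <= a <= T.
Proof. by rewrite a_ge0 (le_trans ab). Qed.

(** Over the step the slope departs from its initial value by at most [Lam] times the displacement
    of the state, itself O(b - a); the mean value inequality supplies the second factor [b - a]. *)
Lemma x_consistency :
  norm2 (x b - x a - (b - a) *: x_field E beta (x a) (v ^~ a)) <=
  Lam * (k.+1)%:R * S * (b - a) ^+ 2.
Proof.
rewrite expr2 mulrA -2!(mulrA Lam).
apply: (@mean_value_norm2 R N x (fun s => x_field E beta (x s) (v ^~ s))) => //.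
- exact: continuous_subspaceW (sub_step (lexx b)) xc.
- by move=> s /step_in; exact: xP.
move=> s sab; rewrite (le_trans (x_field_lipschitz_solution _ (step_in_cc sab) _)) //.
  by move=> i; exact: solution_unit.
by rewrite ler_wpM2l ?field_lipschitz_const_ge0 ?solution_displacement.
Qed.

Lemma v_consistency i :
  norm2 (v i b - v i a - (b - a) *: v_field E gamma (x a) (v ^~ a) i) <=
  Lam * (k.+1)%:R * S * (b - a) ^+ 2.
Proof.
rewrite expr2 mulrA -2!(mulrA Lam).
apply: (@mean_value_norm2 R N (v i) (fun s => v_field E gamma (x s) (v ^~ s) i)) => //.
- exact: continuous_subspaceW (sub_step (lexx b)) (vc i).
- by move=> s /step_in; exact: vP.
move=> s sab; rewrite (le_trans (v_field_lipschitz_solution _ _ (step_in_cc sab) _)) //.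
  by move=> j; exact: solution_unit.
by rewrite ler_wpM2l ?field_lipschitz_const_ge0 ?solution_displacement.
Qed.

End Step.
End Solution.

(** * Convergence of the scheme *)

Section Convergence.
Set Implicit Arguments.
Unset Strict Implicit.
Context {R : realType}.

(** The factor [n%:R * c] replaces the geometric sum and so avoids dividing by [lam], which may
    vanish. *)
Lemma discrete_gronwall (e : nat -> R) (lam c : R) (M : nat) :
  0 <= lam -> 0 <= c -> e 0%N <= 0 ->
  (forall n, (n < M)%N -> e n.+1 <= (1 + lam) * e n + c) ->
  forall n, (n <= M)%N -> e n <= n%:R * c * (1 + lam) ^+ n.
Proof.
move=> lam0 c0 e0 eS; elim=> [|n IH] nM; first by rewrite mul0r mul0r.
have lam1 : 0 <= 1 + lam by rewrite addr_ge0.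
apply: (le_trans (eS n nM)).
rewrite -natr1 (mulrDl n%:R) mul1r (mulrDl _ _ (_ ^+ _)) lerD //.
  by rewrite exprS mulrCA ler_wpM2l // IH // ltnW.
by rewrite ler_peMr // exprn_ege1 // lerDl.
Qed.

Lemma norm2_euler_step N (yb ya yn f fn : 'cV[R]_N) (tau : R) : 0 <= tau ->
  norm2 (yb - (yn + tau *: fn)) <=
  norm2 (yb - ya - tau *: f) + norm2 (ya - yn) + tau * norm2 (f - fn).
Proof.
move=> tau0; have -> : yb - (yn + tau *: fn) =
    (yb - ya - tau *: f) + (ya - yn) + tau *: (f - fn).
  by apply/matrixP => a b; rewrite !mxE; ring.
rewrite (le_trans (norm2D _ _)) // norm2Z ger0_norm // lerD2r; exact: norm2D.
Qed.

(** Total of [k.+1] consistency errors, one per component of the state, and of [k] Gram-Schmidt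
    corrections. *)
Definition local_error_const (k : nat) (L T beta gamma rho : R) : R :=
  (k.+1)%:R * (field_lipschitz_const k L T beta gamma rho * (k.+1)%:R
               * speed_bound k L T beta gamma rho)
  + k%:R * (7 ^+ k * speed_bound k L T beta gamma rho ^+ 2).

Context {N k : nat} (E : 'cV[R]_N -> R) (L T beta gamma rho : R).
Context (x0 : 'cV[R]_N) (v0 : 'I_k -> 'cV[R]_N).
Context (x : R -> 'cV[R]_N) (v : 'I_k -> R -> 'cV[R]_N).
Hypotheses (L_ge0 : 0 <= L) (T_ge0 : 0 <= T).
Hypotheses (beta_ge0 : 0 <= beta) (gamma_ge0 : 0 <= gamma).
Hypotheses (E_diff : twice_differentiable E) (E_lip : assumptionA E L).
Hypotheses (x0_norm : norm2 x0 = rho) (v0_orthonormal : orthonormal_family v0).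
Hypothesis sol : saddle_solution E beta gamma T x0 v0 x v.

Context (NT : nat) (tau : R) (xn : nat -> 'cV[R]_N) (vn : 'I_k -> nat -> 'cV[R]_N).
Hypotheses (tau_ge0 : 0 <= tau) (tau_T : NT%:R * tau = T).
Hypothesis scheme : euler_scheme E beta gamma tau NT x0 v0 xn vn.

Let S := speed_bound k L T beta gamma rho.
Let Lam := field_lipschitz_const k L T beta gamma rho.
Let C := local_error_const k L T beta gamma rho.

Hypothesis tau_small : 7 ^+ k * (S ^+ 2 * tau ^+ 2) <= 2^-1.

Let S_ge0 : 0 <= S.
Proof. exact: speed_bound_ge0. Qed.

Let Lam_ge0 : 0 <= Lam.
Proof. exact: field_lipschitz_const_ge0. Qed.

Lemma local_error_const_ge0 : 0 <= C.
Proof. by rewrite addr_ge0 // !mulr_ge0 // ?exprn_ge0 ?sqr_ge0. Qed.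

(* The O(tau) terms of the Gram matrix of the predictors cancel, so that the
   Gram-Schmidt step only perturbs them by O(tau^2). *)
Lemma gram_schmidt_step n : (n < NT)%N -> orthonormal_family (vn ^~ n) ->
  orthonormal_family (vn ^~ n.+1) /\
  forall i, norm2 (vn i n.+1 - (vn i n + tau *: v_field E gamma (xn n) (vn ^~ n) i)) <=
    7 ^+ k * (S ^+ 2 * tau ^+ 2).
Proof.
move=> nNT vnP; have [_ _ /(_ n.+1 nNT) [_ vS]] := scheme.
pose d := v_field E gamma (xn n) (vn ^~ n).
apply: (gram_schmidt_perturbation (vt := fun i => vn i n + tau *: d i) (v := vn ^~ n.+1)
  _ tau_small vS) => i j.
change (`|dot (vn i n + tau *: d i) (vn j n + tau *: d j) - (i == j)%:R|
        <= S ^+ 2 * tau ^+ 2).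
have := dot_v_field_orthonormal gamma E_diff E_lip L_ge0 (xn n) i j vnP.
rewrite -/d => skew.
have d_le l : norm2 (d l) <= S.
  by apply: v_speed => // m; rewrite norm2_unit // vnP eqxx.
clearbody d; rewrite !(dotDl, dotDr, dotZl, dotZr) vnP.
have -> : (i == j)%:R + tau * dot (vn i n) (d j)
    + (tau * dot (d i) (vn j n) + tau * (tau * dot (d i) (d j))) - (i == j)%:R =
    tau * (dot (d i) (vn j n) + dot (vn i n) (d j)) + tau ^+ 2 * dot (d i) (d j).
  by ring.
rewrite skew mulr0 add0r normrM ger0_norm ?sqr_ge0 // mulrC.
rewrite ler_wpM2r ?sqr_ge0 // (le_trans (normr_dot_le _ _)) // expr2.
by rewrite ler_pM ?norm2_ge0.
Qed.

(** Orthonormality at one step is what makes the predictors nearly orthonormal, hence the next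
    normalisation nondegenerate. *)
Lemma scheme_orthonormal n : (n <= NT)%N -> orthonormal_family (vn ^~ n).
Proof.
elim: n => [_|n IH nNT]; last by have [] := gram_schmidt_step nNT (IH (ltnW nNT)).
by have [_ vn0 _] := scheme; move=> i j; rewrite !vn0.
Qed.

Let err n := state_dist (x (n%:R * tau)) (v ^~ (n%:R * tau)) (xn n) (vn ^~ n).

Lemma error_step n : (n < NT)%N ->
  err n.+1 <= (1 + (k.+1)%:R * Lam * tau) * err n + C * tau ^+ 2.
Proof.
move=> nNT; have vnP := scheme_orthonormal (ltnW nNT).
have [_ gs] := gram_schmidt_step nNT vnP.
have [_ _ /(_ n.+1 nNT) [/= xS _]] := scheme.
have vn1 i : norm2 (vn i n) = 1 by rewrite norm2_unit // vnP eqxx.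
set a := n%:R * tau; set b := n.+1%:R * tau.
have a0 : 0 <= a by rewrite mulr_ge0.
have ba : b - a = tau by rewrite /a /b -natr1; ring.
have ab : a <= b by rewrite -subr_ge0 ba.
have bT : b <= T by rewrite -tau_T ler_wpM2r // ler_nat.
have aT : 0 <= a <= T by rewrite a0 (le_trans ab).
have x_err : norm2 (x b - xn n.+1) <=
    Lam * (k.+1)%:R * S * tau ^+ 2 + norm2 (x a - xn n) + tau * (Lam * err n).
  rewrite xS; apply: (le_trans (norm2_euler_step _ (x a) _
    (x_field E beta (x a) (v ^~ a)) _ tau_ge0)).
  apply: lerD; first apply: lerD => //.
    by rewrite -ba; exact: (x_consistency L_ge0 T_ge0 beta_ge0 gamma_ge0 E_diff E_lip
      x0_norm v0_orthonormal sol).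
  rewrite ler_wpM2l //.
  exact: (x_field_lipschitz_solution L_ge0 T_ge0 beta_ge0 gamma_ge0 E_diff E_lip
      x0_norm v0_orthonormal sol).
have v_err i : norm2 (v i b - vn i n.+1) <= norm2 (v i a - vn i n)
    + (Lam * (k.+1)%:R * S * tau ^+ 2 + tau * (Lam * err n)
       + 7 ^+ k * (S ^+ 2 * tau ^+ 2)).
  apply: (le_trans (norm2_le_add _
    (vn i n + tau *: v_field E gamma (xn n) (vn ^~ n) i) _)).
  rewrite addrA lerD //; last by rewrite norm2BC.
  apply: (le_trans (norm2_euler_step _ (v i a) _
    (v_field E gamma (x a) (v ^~ a) i) _ tau_ge0)).
  rewrite addrA lerD //; last first.
    rewrite ler_wpM2l //.
    exact: (v_field_lipschitz_solution _ L_ge0 T_ge0 beta_ge0 gamma_ge0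
      E_diff E_lip v0_orthonormal sol).
  rewrite [leRHS]addrC lerD2r.
  by rewrite -ba; exact: (v_consistency L_ge0 T_ge0 beta_ge0 gamma_ge0 E_diff E_lip
      x0_norm v0_orthonormal sol).
rewrite {1}/err /state_dist -/b.
have err_ge0 : 0 <= err n by exact: state_dist_ge0.
apply: (le_trans (lerD x_err
  (sumr_le_add_const (P := xpredT) _ _ (fun i _ => v_err i)))).
- by apply: addr_ge0; [apply: addr_ge0|]; rewrite !mulr_ge0 ?exprn_ge0.
- by move=> i; exact: norm2_ge0.
rewrite -natr1 /C /local_error_const -/S -/Lam -natr1.
have errE : err n = norm2 (x a - xn n) + \sum_(i < k) norm2 (v i a - vn i n) by [].
(* The summed bounds equal the right-hand side exactly, by the choice of [local_error_const]. *)
rewrite le_eqVlt; apply/orP; left; apply/eqP; move: errE.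
by move: (err n) (norm2 (x a - xn n)) (\sum_(_ < _) _) => e d s ->; ring.
Qed.

Lemma error_bound n : (n <= NT)%N ->
  err n <= T * C * expR ((k.+1)%:R * Lam * T) * tau.
Proof.
move=> nNT; have lam0 : 0 <= (k.+1)%:R * Lam * tau by rewrite !mulr_ge0.
have C0 := local_error_const_ge0.
have err0 : err 0 <= 0.
  have [[x00 v00] _ _ _] := sol; have [xn0 vn0 _] := scheme.
  rewrite /err mul0r /state_dist x00 xn0 subrr norm2_0 add0r big1 // => i _.
  by rewrite v00 vn0 subrr norm2_0.
have nT : n%:R * tau <= T by rewrite -tau_T ler_wpM2r // ler_nat.
apply: (le_trans (discrete_gronwall lam0 _ err0 error_step nNT)).
  by rewrite mulr_ge0 ?sqr_ge0.
have -> : n%:R * (C * tau ^+ 2) = n%:R * tau * C * tau by ring.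
rewrite [leRHS]mulrAC; apply: ler_pM; rewrite ?exprn_ge0 ?addr_ge0 ?mulr_ge0 //.
  by rewrite ler_wpM2r // ler_wpM2r.
(* From 1 + z <= exp z; the power is then bounded uniformly in [n] because [n%:R * tau <= T]. *)
apply: (@le_trans _ _ (expR ((k.+1)%:R * Lam * tau) ^+ n)).
  by rewrite lerXn2r ?nnegrE ?expR_ge0 ?addr_ge0 ?expR_ge1Dx.
rewrite -expRM_natl ler_expR mulrCA ler_wpM2l //.
by rewrite mulr_ge0.
Qed.

End Convergence.

Theorem theorem4p3 (R : realType) (k : nat) (L T beta gamma rho : R) :
  (1 < k)%N -> 0 < L -> 0 < T -> 0 < beta -> 0 < gamma ->
  exists Q tau0 : R, 0 < tau0 /\
    forall (N : nat) (E : 'cV[R]_N -> R)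
           (x0 : 'cV[R]_N) (v0 : 'I_k -> 'cV[R]_N)
           (x : R -> 'cV[R]_N) (v : 'I_k -> R -> 'cV[R]_N),
      twice_differentiable E -> assumptionA E L ->
      norm2 x0 = rho -> orthonormal_family v0 ->
      saddle_solution E beta gamma T x0 v0 x v ->
      forall (NT : nat) (tau : R)
             (xn : nat -> 'cV[R]_N) (vn : 'I_k -> nat -> 'cV[R]_N),
        (0 < NT)%N -> tau = T / NT%:R -> tau <= tau0 ->
        euler_scheme E beta gamma tau NT x0 v0 xn vn ->
        forall n : nat, (1 <= n <= NT)%N ->
          norm2 (x (n%:R * tau) - xn n)
            + \sum_(i < k) norm2 (v i (n%:R * tau) - vn i n) <= Q * tau.
Proof.
move=> _ /ltW L0 /ltW T0 /ltW beta0 /ltW gamma0.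
pose S := speed_bound k L T beta gamma rho.
pose D := 7 ^+ k * S ^+ 2.
have D0 : 0 <= D by rewrite mulr_ge0 ?sqr_ge0 ?exprn_ge0.
exists (T * local_error_const k L T beta gamma rho
        * expR ((k.+1)%:R * field_lipschitz_const k L T beta gamma rho * T)).
(* This threshold ensures both [tau <= 1] and [D * tau <= 2^-1], hence the smallness
   [D * tau ^+ 2 <= 2^-1] required by Gram-Schmidt; the added 1 keeps it meaningful when [D = 0]. *)
exists (2 * D + 1)^-1; split; first by rewrite invr_gt0 ltr_wpDl // mulr_ge0.
move=> N E x0 v0 x v E_diff E_lip x0_norm v0P sol NT tau xn vn NT0 tauE tau_le scheme.
move=> n /andP[_ nNT].
have NT_gt0 : 0 < NT%:R :> R by rewrite ltr0n.
have tau0 : 0 <= tau by rewrite tauE divr_ge0.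
have tau_D : (2 * D + 1) * tau <= 1.
  by rewrite -ler_pdivlMl ?mulr1 // ltr_wpDl // mulr_ge0.
apply: (error_bound L0 T0 beta0 gamma0 E_diff E_lip x0_norm v0P sol tau0 _ scheme _ nNT).
  by rewrite tauE mulrC divfK // gt_eqF.
rewrite -/S mulrA -/D; have Dtau : 0 <= D * tau by rewrite mulr_ge0.
have tau1 : tau <= 1 by lra.
rewrite expr2 mulrA; have := ler_wpM2l Dtau tau1; lra.
Qed.
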